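(* The move (R) is robust. Explicitly: let $\Lambda$ be a $k$-graph and $w\in\Lambda^0$ such that $(\Lambda,w)$ satisfies $H_R$ with color set $B\subseteq E_k$ (and fixed $b\in B$), and let $\Omega$ be any $j$-graph. Then for every $y\in\Omega^0$ the pair $(\Lambda\times\Omega,(w,y))$ satisfies $H_R$ with color set $B$, regarded as a subset of $E_{k+j}=E_k\sqcup E_j$; and, forming the reduction $(\Lambda\times\Omega)_R$ (with the same $b$), there is an isomorphism of higher-rank graphs $\Phi:\Lambda_R\times\Omega\to(\Lambda\times\Omega)_R$ such that $\operatorname{par}_\times\circ\Phi=\operatorname{par}\times\mathrm{id}_\Omega$, where $\operatorname{par}:\Lambda_R\to\Lambda$ and $\operatorname{par}_\times:(\Lambda\times\Omega)_R\to\Lambda\times\Omega$ are the parent functors of the two reductions.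
   Context: **$k$-graphs.** $0\in\mathbb N$; $E=E_k=\{e_1,\dots,e_k\}$ is the standard basis of $\mathbb N^k$, whose elements are called colors. A $k$-graph is a countable category $\Lambda$ with a functor $d:\Lambda\to\mathbb N^k$ such that for every $\lambda\in\Lambda$ and $m,n\in\mathbb N^k$ with $d(\lambda)=m+n$ there are unique $\mu,\nu\in\Lambda$ with $d(\mu)=m$, $d(\nu)=n$, $\lambda=\mu\nu$. Composition is from right to left. For $A\subseteq\mathbb N^k$, $\Lambda^A=\{\lambda:d(\lambda)\in A\}$, $\Lambda^n=\Lambda^{\{n\}}$; $\Lambda^0$ is the set of vertices (identified with objects) and $\Lambda^E$ the set of edges; $s,r$ are source and range; $w\Lambda^A=\{\lambda\in\Lambda^A:r(\lambda)=w\}$, $\Lambda^Av=\{\lambda\in\Lambda^A:s(\lambda)=v\}$, $w\Lambda^Av=w\Lambda^A\cap\Lambda^Av$. The 1-skeleton $G(\Lambda)$ is the directed graph $(\Lambda^0,\Lambda^E,s,r)$ with edges colored by $d$; $G(\Lambda)^*$ is its path category; for paths, $\mu\sim\nu$ means that $\mu$ and $\nu$ have the same composite in $\Lambda$. An isomorphism of higher-rank graphs is a bijective degree-preserving functor. The product of a $k$-graph $\Lambda$ and a $j$-graph $\Omega$ is the $(k+j)$-graph $\Lambda\times\Omega$ (product category, degree $(d(\lambda),d(\omega))\in\mathbb N^k\times\mathbb N^j\cong\mathbb N^{k+j}$). **Reducibility.** A vertex $w$ is reducible with color set $\emptyset\ne B\subseteq E$ if there is $v\in\Lambda^0$ such that: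 every $\mu\in w\Lambda^Ev$ has $d(\mu)\in B$; for all $b\in B$, $w\Lambda^b=\{f_b\}$ is a singleton; $w\notin r(\Lambda^Bw)$; and $s(w\Lambda^B)=\{v\}$. Put $\mathcal E=E\setminus B$. The neighborhood $U_w^{\mathcal E}$ is the (undirected) connected component containing $w$ of the subgraph of $G(\Lambda)$ with vertex set $\Lambda^0$ and edge set $\Lambda^{\mathcal E}$; $(U_w^{\mathcal E})^0$ and $(U_w^{\mathcal E})^E$ are its vertices and edges, and for a vertex $x$, $x\in U_w^{\mathcal E}$ means $x\in(U_w^{\mathcal E})^0$. $w$ is fully reducible with color set $B$ if each $x\in(U_w^{\mathcal E})^0$ is reducible with color set $B$ and $\big(\bigcup_{x\in (U_w^{\mathcal E})^0}\Lambda^Bx\big)\cap\big(\bigcup_{x\in (U_w^{\mathcal E})^0}x\Lambda^B\big)=\emptyset$. For $x\in(U_w^{\mathcal E})^0$ and $b\in B$, $f_{b,x}$ denotes the unique edge of color $b$ with range $x$. **Stationary.** A set $\mathcal F\subseteq\Lambda^E$ is stationary in color set $B$ if for all $f_1,f_2\in\mathcal F$: $s(f_1)=s(f_2)$ and $r(f_1)=r(f_2)$; if $\lambda\in\Lambda^Br(f_1)$ and $\lambda f_1\sim\nu\mu$ (with $\nu,\mu$ edges), then $\mu\in\mathcal F$; if $\lambda\in s(f_1)\Lambda^B$ and $f_1\lambda\sim\nu\mu$ (with $\nu,\mu$ edges), then $\nu\in\mathcal F$. **Hypotheses $H_R$ (with color set $B$).** $w$ is fully reducible with color set $B$, and for every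 $x\in(U_w^{\mathcal E})^0$ the set $x\Lambda^B$ is stationary with color set $B$. **Reduction (R).** For $(\Lambda,w)$ satisfying $H_R$, define a colored directed graph $G(\Lambda_R)$ by $\Lambda_R^0=\Lambda^0\setminus(U_w^{\mathcal E})^0$, $\Lambda_R^E=\Lambda^E\setminus\big((U_w^{\mathcal E})^E\cup\bigcup_{x\in(U_w^{\mathcal E})^0}x\Lambda^B\big)$, with edges keeping their colors, $r_R(\mu)=r(\mu)$, and $s_R(\mu)=s(f_{b,s(\mu)})$ if $s(\mu)\in U_w^{\mathcal E}$, $s_R(\mu)=s(\mu)$ otherwise. Let $\iota:\Lambda_R^E\to\Lambda^E$ be the inclusion. Fix $b\in B$. Define $\operatorname{par}$ on edges by $\operatorname{par}(\mu)=\iota(\mu)f_{b,s(\iota(\mu))}$ if $s(\iota(\mu))\in(U_w^{\mathcal E})^0$ and $\operatorname{par}(\mu)=\iota(\mu)$ otherwise, by the identity on vertices, and extend multiplicatively to paths. Define $\sim_R$ on $G(\Lambda_R)^*$: on vertices and edges it is equality; for paths $\mu,\nu$ of length at least 2, $\mu\sim_R\nu$ iff $\operatorname{par}(\mu)=\operatorname{par}(\nu)$ in $\Lambda$. Then $\Lambda_R=G(\Lambda_R)^*/\sim_R$ is a $k$-graph and $\operatorname{par}$ induces a functor $\operatorname{par}:\Lambda_R\to\Lambda$, called the parent functor.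
   Formalization: The existence of Φ is stated only for connected Ω (any two vertices joined by an undirected path); for disconnected Ω it always fails, since (w,z) with z outside the component of y survives in (Λ×Ω)_R but is not over Λ_R. The H_R part holds for any Ω. *)

(* Defs.v *)
From HB Require Import structures.
From Stdlib Require Import Relation_Operators.
From mathcomp Require Import all_boot all_algebra.
From mathcomp Require Import boolp classical_sets.

Set Implicit Arguments.
Unset Strict Implicit.
Unset Printing Implicit Defensive.

Import GRing.Theory.
Local Open Scope classical_set_scope.
Local Open Scope quotient_scope.
Local Open Scope ring_scope.

Local Obligation Tactic := idtac.

(* A k-graph is presented by its morphisms and its vertices (the objects).
   The composition [comp f g], with g first, is total, but it is meaningful
   only if [src f = rng g]; no law constrains its other values.
   Countability is the [countType] structure on vertices and morphisms.      *)
Record kgraph (k : nat) := KGraph {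
  vert : countType;
  mor : countType;
  src : mor -> vert;
  rng : mor -> vert;
  idm : vert -> mor;
  comp : mor -> mor -> mor;
  deg : mor -> 'rV[nat]_k;
  src_idm : forall v, src (idm v) = v;
  rng_idm : forall v, rng (idm v) = v;
  src_comp : forall f g, src f = rng g -> src (comp f g) = src g;
  rng_comp : forall f g, src f = rng g -> rng (comp f g) = rng f;
  comp_idl : forall f, comp (idm (rng f)) f = f;
  comp_idr : forall f, comp f (idm (src f)) = f;
  compA : forall f g h, src f = rng g -> src g = rng h ->
    comp f (comp g h) = comp (comp f g) h;
  deg_idm : forall v, deg (idm v) = 0;
  deg_comp : forall f g, src f = rng g -> deg (comp f g) = deg f + deg g;
  factorization : forall f m n, deg f = m + n ->
    exists! p : mor * mor,
      [/\ src p.1 = rng p.2, deg p.1 = m, deg p.2 = n & f = comp p.1 p.2]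
}.

Section Functors.
Context (k l : nat).

Record functor (L : kgraph k) (G : kgraph l) := Functor {
  fvert : vert L -> vert G;
  fmor : mor L -> mor G;
  functor_src : forall f, src (fmor f) = fvert (src f);
  functor_rng : forall f, rng (fmor f) = fvert (rng f);
  functor_idm : forall v, fmor (idm v) = idm (fvert v);
  functor_comp : forall f g, src f = rng g ->
    fmor (comp f g) = comp (fmor f) (fmor g)
}.

Definition functor_eq (L : kgraph k) (G : kgraph l) (F F' : functor L G) :=
  fvert F =1 fvert F' /\ fmor F =1 fmor F'.

End Functors.

Definition kgraph_iso k (L G : kgraph k) (F : functor L G) :=
  [/\ bijective (fvert F), bijective (fmor F)
    & forall f, deg (fmor F f) = deg f].

Program Definition functor_id k (L : kgraph k) : functor L L :=
  @Functor _ _ L L id id _ _ _ _.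
Next Obligation. by []. Qed.
Next Obligation. by []. Qed.
Next Obligation. by []. Qed.
Next Obligation. by []. Qed.

Program Definition functor_compose k l m (L : kgraph k) (G : kgraph l)
    (H : kgraph m) (F' : functor G H) (F : functor L G) : functor L H :=
  @Functor _ _ L H (fvert F' \o fvert F) (fmor F' \o fmor F) _ _ _ _.
Next Obligation. by move=> *; rewrite /= !functor_src. Qed.
Next Obligation. by move=> *; rewrite /= !functor_rng. Qed.
Next Obligation. by move=> *; rewrite /= !functor_idm. Qed.
Next Obligation.
by move=> * /=; rewrite !functor_comp // functor_src functor_rng; congr fvert.
Qed.

Section Basics.
Context (k : nat) (L : kgraph k).
Implicit Types (f g h : mor L) (v w x : vert L) (C : {set 'I_k}).

Lemma rVnat_addI (m n p : 'rV[nat]_k) : m + n = m + p -> n = p.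
Proof.
move=> /matrixP E; apply/matrixP => i j.
by have := E i j; rewrite !mxE => /addnI.
Qed.

Lemma factor_exists f m n : deg f = m + n ->
  exists g h, [/\ src g = rng h, deg g = m, deg h = n & f = comp g h].
Proof. by move=> /factorization [[g h] [[/= ? ? ? ?] _]]; exists g, h. Qed.

Lemma factor_unique f g f' g' : src f = rng g -> src f' = rng g' ->
  comp f g = comp f' g' -> deg f = deg f' -> f = f' /\ g = g'.
Proof.
move=> c c' E d.
have dg : deg g = deg g'.
  by apply: (@rVnat_addI (deg f)); rewrite -deg_comp // E deg_comp // d.
have [p [_ pU]] := factorization (deg_comp c).
have E1 : p = (f, g) by apply: pU; split.
have E2 : p = (f', g') by apply: pU; split; rewrite /= ?d ?dg.
by move: E2; rewrite E1 => -[-> ->].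
Qed.

Lemma deg0_idm f : deg f = 0 -> f = idm (src f).
Proof.
move=> d; apply: (proj2 (factor_unique (f := idm (rng f)) (f' := f) _ _ _ _)).
- by rewrite src_idm.
- by rewrite rng_idm.
- by rewrite comp_idl comp_idr.
- by rewrite deg_idm d.
Qed.

(* The set of edges with color in C; [edges setT] is the set of all edges.
   The color c of 'I_k stands for the basis vector delta_mx 0 c of N^k.      *)
Definition edges C : set (mor L) :=
  [set f | exists2 c, c \in C & deg f = delta_mx 0 c].
Definition edges_into C x : set (mor L) := edges C `&` [set f | rng f = x].
Definition edges_from C x : set (mor L) := edges C `&` [set f | src f = x].

Definition adjacent C x y :=
  exists2 e, edges C e & src e = x /\ rng e = y.
Definition nbhd C w : set (vert L) :=
  [set x | clos_refl_sym_trans _ (adjacent C) w x].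
Definition nbhd_edges C w : set (mor L) :=
  [set e | [/\ edges C e, nbhd C w (src e) & nbhd C w (rng e)]].
Definition connected_kgraph := forall x y, nbhd [set: 'I_k]%SET x y.

Definition reducible w (B : {set 'I_k}) :=
  B != finset.set0 /\
  exists v, [/\
    forall f, edges [set: 'I_k]%SET f -> rng f = w -> src f = v -> edges B f,
    forall b, b \in B -> exists! f, rng f = w /\ deg f = delta_mx 0 b,
    ~ [set rng f | f in edges_from B w] w &
    [set src f | f in edges_into B w] = [set v]].

Definition fully_reducible w (B : {set 'I_k}) :=
  let U := nbhd (~: B)%SET w in
  (forall x, U x -> reducible x B) /\
  (\bigcup_(x in U) edges_from B x) `&` (\bigcup_(x in U) edges_into B x)
    = set0.

Definition stationary (B : {set 'I_k}) (F : set (mor L)) :=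
  let edge := edges [set: 'I_k]%SET in
  F `<=` edge /\
  forall f1 f2, F f1 -> F f2 -> [/\
    src f1 = src f2,
    rng f1 = rng f2,
    forall l nu mu, edges_from B (rng f1) l -> edge nu -> edge mu ->
      src nu = rng mu -> comp l f1 = comp nu mu -> F mu &
    forall l nu mu, edges_into B (src f1) l -> edge nu -> edge mu ->
      src nu = rng mu -> comp f1 l = comp nu mu -> F nu].

Definition HR w (B : {set 'I_k}) :=
  fully_reducible w B /\
  forall x, nbhd (~: B)%SET w x -> stationary B (edges_into B x).

End Basics.

(* The path category of a directed graph: a path is a pair of its range and
   the list of its edges, the last one travelled first.                      *)
Section Paths.
Context (V E : countType) (s r : E -> V).

Fixpoint chain (v : V) (es : seq E) :=
  if es is e :: es' then (r e == v) && chain (s e) es' else true.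
Definition dpath := {p : V * seq E | chain p.1 p.2}.
Definition path_rng (p : dpath) := (val p).1.
Definition path_edges (p : dpath) := (val p).2.
Definition path_src (p : dpath) := last (path_rng p) (map s (path_edges p)).
Definition path_nil (v : V) : dpath := exist _ (v, [::]) isT.
(* The value p if p and q are not composable is a placeholder. *)
Definition path_cat (p q : dpath) : dpath :=
  insubd p (path_rng p, path_edges p ++ path_edges q).

Lemma chain_cat v es es' :
  chain v (es ++ es') = chain v es && chain (last v (map s es)) es'.
Proof. by elim: es v => //= e es IH v; rewrite IH andbA. Qed.

Lemma path_catE p q : path_src p = path_rng q ->
  val (path_cat p q) = (path_rng p, path_edges p ++ path_edges q).
Proof.
move=> c; rewrite val_insubd chain_cat (valP p) /=.
by move: c; rewrite /path_src => ->; rewrite (valP q).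
Qed.

End Paths.

Fixpoint comp_seq k (L : kgraph k) (v : vert L) (es : seq (mor L)) :=
  if es is e :: es' then comp e (comp_seq (src e) es') else idm v.

Section Composites.
Context (k : nat) (L : kgraph k).
Implicit Types (e f g h : mor L) (es : seq (mor L)) (v : vert L).
Local Notation chainL := (chain (@src k L) (@rng k L)).

Lemma comp_seq_rng v es : chainL v es -> rng (comp_seq v es) = v.
Proof.
elim: es v => [|e es IH] v /=; first by rewrite rng_idm.
by move=> /andP[/eqP <- c]; rewrite rng_comp // IH.
Qed.

Lemma comp_seq_src v es : chainL v es ->
  src (comp_seq v es) = last v (map (@src k L) es).
Proof.
elim: es v => [|e es IH] v /=; first by rewrite src_idm.
by move=> /andP[_ c]; rewrite src_comp ?comp_seq_rng // IH.
Qed.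

Lemma comp_seq_cat v es es' : chainL v (es ++ es') ->
  comp_seq v (es ++ es') =
  comp (comp_seq v es) (comp_seq (last v (map (@src k L) es)) es').
Proof.
elim: es v => [|e es IH] v /=.
  by move=> c; rewrite -{2}(comp_seq_rng c) comp_idl.
move=> /andP[_ c]; rewrite IH //.
move: c; rewrite chain_cat => /andP[c c'].
by rewrite compA ?comp_seq_rng ?comp_seq_src.
Qed.

Lemma comp_seq_deg v es : chainL v es ->
  deg (comp_seq v es) = \sum_(e <- es) deg e.
Proof.
elim: es v => [|e es IH] v /=; first by rewrite big_nil deg_idm.
by move=> /andP[_ c]; rewrite big_cons deg_comp ?comp_seq_rng // IH.
Qed.

Lemma delta_mx_nat_neq0 (c : 'I_k) : (delta_mx 0 c : 'rV[nat]_k) <> 0.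
Proof. by move=> /matrixP /(_ 0 c); rewrite !mxE !eqxx. Qed.

Lemma delta_mx_nat_inj (c d : 'I_k) :
  (delta_mx 0 c : 'rV[nat]_k) = delta_mx 0 d -> c = d.
Proof. by move=> /matrixP /(_ 0 c); rewrite !mxE !eqxx /=; case: eqP. Qed.

Lemma delta_mx_nat_sum (c : 'I_k) :
  (\sum_i (delta_mx 0%R c : 'rV[nat]_k) ord0 i)%N = 1%N.
Proof.
rewrite (bigD1 c) //= big1 => [|i /negPf ic]; first by rewrite mxE !eqxx.
by rewrite mxE ic andbF.
Qed.

Lemma factor_color f c : deg f ord0 c != 0 ->
  exists g h, [/\ src g = rng h, deg g = delta_mx 0 c & f = comp g h].
Proof.
move=> dc.
have : deg f = delta_mx 0 c + \row_i (deg f ord0 i - (i == c))%N.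
  apply/rowP => i; rewrite !mxE eqxx /=.
  by case: eqP => [->|_] //=; [rewrite [RHS]subnKC // lt0n | rewrite subn0].
by move=> /factor_exists [g [h [cp dg _ E]]]; exists g, h.
Qed.

Lemma edge_seq_size v es : chainL v es ->
  {in es, forall e, edges [set: 'I_k]%SET e} ->
  size es = (\sum_i deg (comp_seq v es) ord0 i)%N.
Proof.
move=> c; rewrite comp_seq_deg // => {c}.
elim: es => [|e es IH] ed.
  by rewrite big_nil big1 // => i _; rewrite mxE.
rewrite big_cons /= IH => [|a aes]; last by apply: ed; rewrite inE aes orbT.
have [c _ ->] := ed e (mem_head _ _).
under [RHS]eq_bigr => i _ do rewrite mxE.
by rewrite big_split /= delta_mx_nat_sum.
Qed.

Lemma edge_seq_exists f : exists es,
  [/\ chainL (rng f) es, {in es, forall e, edges [set: 'I_k]%SET e}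
    & f = comp_seq (rng f) es].
Proof.
have [n] := ubnP (\sum_i deg f ord0 i)%N.
elim: n f => // n IH f ltn.
have [d0|/rV0Pn [c dc]] := eqVneq (deg f) 0.
  exists [::]; split=> //=; have f_id := deg0_idm d0.
  by rewrite f_id rng_idm.
have [e [g [cp de E]]] := factor_color dc.
have [|es [c1 ed E']] := IH g.
  rewrite -ltnS; apply: leq_ltn_trans ltn; rewrite E.
  under [X in (_ < X)%N]eq_bigr => i _ do rewrite deg_comp // mxE.
  by rewrite big_split /= de delta_mx_nat_sum.
exists (e :: es); split=> /=.
- by rewrite E rng_comp // eqxx cp.
- move=> a; rewrite inE => /orP[/eqP ->|/ed //].
  by exists c; rewrite ?inE.
- by rewrite cp -E' E.
Qed.

End Composites.

Section Reduction.
Context (k : nat) (L : kgraph k) (w : vert L) (B : {set 'I_k}) (b : 'I_k).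
Hypotheses (hb : b \in B) (H : HR w B).
Local Notation U := (nbhd (~: B)%SET w).
Local Notation edge := (edges [set: 'I_k]%SET).
Local Notation chainL := (chain (@src k L) (@rng k L)).
Implicit Types (e f g h : mor L) (x v : vert L).

Definition in_nbhd x : bool := `[< U x >].

(* f_{b,x}; the default value idm x is not taken when x is in U. *)
Definition fedge x : mor L :=
  xget (idm x) [set f | rng f = x /\ deg f = delta_mx 0 b].

Lemma edges_sub (C : {set 'I_k}) e : edges C e -> edge e.
Proof. by case=> c _ dc; exists c; rewrite ?inE. Qed.

Lemma edges_split e : edge e -> edges B e \/ edges (~: B)%SET e.
Proof.
case=> c _ dc; have [cB|cB] := boolP (c \in B); first by left; exists c.
by right; exists c; rewrite ?inE.
Qed.

Lemma edges_disj e : edges B e -> edges (~: B)%SET e -> False.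
Proof.
move=> [c cB dc] [d]; rewrite dc !inE => /negP dB /delta_mx_nat_inj cd.
by apply: dB; rewrite -cd.
Qed.

Lemma nbhd_closed e : edges (~: B)%SET e ->
  in_nbhd (src e) = in_nbhd (rng e).
Proof.
move=> ed.
have st : adjacent (~: B)%SET (src e) (rng e) by exists e.
apply/asboolP/asboolP => Ux; apply: rst_trans Ux _.
  exact: rst_step.
exact/rst_sym/rst_step.
Qed.

Lemma fedgeP x : in_nbhd x ->
  rng (fedge x) = x /\ deg (fedge x) = delta_mx 0 b.
Proof.
move=> /asboolP Ux; have [_ [v [_ /(_ _ hb) [f [fP _]] _ _]]] := H.1.1 _ Ux.
exact: (xgetPex (idm x) (P := [set f | rng f = x /\ deg f = delta_mx 0 b])
  (ex_intro _ f fP)).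
Qed.

Lemma fedge_rng x : in_nbhd x -> rng (fedge x) = x.
Proof. by case/fedgeP. Qed.

Lemma fedge_deg x : in_nbhd x -> deg (fedge x) = delta_mx 0 b.
Proof. by case/fedgeP. Qed.

Lemma fedge_edges x : in_nbhd x -> edges B (fedge x).
Proof. by move=> /fedge_deg d; exists b. Qed.

Lemma fedge_unique f : in_nbhd (rng f) -> deg f = delta_mx 0 b ->
  f = fedge (rng f).
Proof.
move=> Ux d.
have [_ [v [_ /(_ _ hb) [f' [_ fU]] _ _]]] := H.1.1 _ (asboolW Ux).
by rewrite -[LHS](fU f) // -(fU (fedge (rng f))) //; apply: fedgeP.
Qed.

Lemma edges_into_disj e : edges B e -> in_nbhd (rng e) -> ~~ in_nbhd (src e).
Proof.
move=> Be /asboolP Ur; apply/negP => /asboolP Us.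
have /seteqP[/(_ e) + _] := H.1.2.
by apply; split; [exists (src e) | exists (rng e)].
Qed.

(* An edge meets the condition below if a path that crosses it enters U from
   outside along a color of B; the number of such edges depends only on the
   composite of a path, which is why red_deg is compatible with red_eq.     *)
Definition crosses e : bool := `[< edges B e >] && in_nbhd (rng e).

Lemma crossesB e : edges B e -> crosses e = in_nbhd (rng e).
Proof. by rewrite /crosses => /asboolT ->. Qed.

Lemma crossesC e : edges (~: B)%SET e -> crosses e = false.
Proof.
by move=> Ce; apply/negP => /andP[/asboolP Be _]; apply: (edges_disj Be).
Qed.

Lemma edges_deg (C : {set 'I_k}) e f : deg e = deg f -> edges C e -> edges C f.
Proof. by move=> d [c cC dc]; exists c; rewrite -?d. Qed.

Lemma crosses_swap_le e f e' f' : edges B e -> edges B f ->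
  src e = rng f -> src e' = rng f' -> comp e f = comp e' f' ->
  edges B e' -> edges B f' -> crosses f -> crosses f'.
Proof.
move=> Be Bf cp cp' E Be' Bf'; rewrite !crossesB // => Uf.
have [_ /(_ f f)] := H.2 _ (asboolW Uf).
case=> // _ _ /(_ e e' f') [] //.
- exact: edges_sub Be'.
- exact: edges_sub Bf'.
- by move=> _ /= ->.
Qed.

Lemma crosses_swap e f e' f' : edge e -> edge f ->
  src e = rng f -> src e' = rng f' -> comp e f = comp e' f' ->
  deg e = deg f' -> deg f = deg e' ->
  (crosses e + crosses f = crosses e' + crosses f')%N.
Proof.
move=> ed fd cp cp' E de df.
have Er : rng e = rng e' by rewrite -(rng_comp cp) E rng_comp.
have [Be|Ce] := edges_split ed; have [Bf|Cf] := edges_split fd.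
- have Be' := edges_deg df Bf; have Bf' := edges_deg de Be.
  rewrite (crossesB Be) (crossesB Be') Er; congr (_ + nat_of_bool _)%N.
  by apply/idP/idP; [apply: (@crosses_swap_le e _ e')
                    |apply: (@crosses_swap_le e' _ e)].
- have Ce' := edges_deg df Cf; have Bf' := edges_deg de Be.
  rewrite (crossesB Be) (crossesC Cf) (crossesC Ce') (crossesB Bf').
  by rewrite -cp' nbhd_closed // Er addn0.
- have Be' := edges_deg df Bf; have Cf' := edges_deg de Ce.
  rewrite (crossesC Ce) (crossesB Bf) (crossesB Be') (crossesC Cf').
  by rewrite -cp nbhd_closed // Er addn0.
- have Ce' := edges_deg df Cf; have Cf' := edges_deg de Ce.
  by rewrite (crossesC Ce) (crossesC Cf) (crossesC Ce') (crossesC Cf').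
Qed.

Lemma crosses_count v es es' : chainL v es -> chainL v es' ->
  {in es, forall e, edge e} -> {in es', forall e, edge e} ->
  comp_seq v es = comp_seq v es' -> count crosses es = count crosses es'.
Proof.
have [n] := ubnP (size es); elim: n v es es' => // n IH v es es' ltn c c' ed ed' E.
have sz : size es = size es' by rewrite (edge_seq_size c) ?E -?edge_seq_size.
case: es es' ltn c c' ed ed' E sz => [|e p] [|e' q] //=; rewrite ltnS.
move=> ltn /andP[/eqP re c] /andP[/eqP re' c'] ed ed' E [sz].
have ep : {in p, forall a, edge a} by move=> a ap; apply: ed; rewrite inE ap orbT.
have eq : {in q, forall a, edge a} by move=> a ap; apply: ed'; rewrite inE ap orbT.
have ee : edge e by apply: ed; rewrite mem_head.
have ee' : edge e' by apply: ed'; rewrite mem_head.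
have cp : src e = rng (comp_seq (src e) p) by rewrite comp_seq_rng.
have cq : src e' = rng (comp_seq (src e') q) by rewrite comp_seq_rng.
have [dee|ndee] := eqVneq (deg e) (deg e').
  have [E1 E2] := factor_unique cp cq E dee.
  by subst e'; rewrite (IH (src e) p q).
have [a _ da] := ee; have [a' _ da'] := ee'.
have [g [h [gh dg Eg]]] : exists g h, [/\ src g = rng h, deg g = deg e' &
    comp_seq (src e) p = comp g h].
  rewrite da'; apply: factor_color.
  have /rowP /(_ a') := congr1 (@deg k L) E.
  rewrite !deg_comp // !mxE da da' !mxE !eqxx /=.
  case: (a' =P a) => [Ea|_]; first by move: ndee; rewrite da da' Ea eqxx.
  by rewrite add0r => ->.
have eg : src e = rng g by rewrite cp Eg rng_comp.
have dcp : deg (comp e g) = deg e' + deg e by rewrite deg_comp // dg addrC.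
have [e2 [g2 [c2 de2 dg2 E2]]] := factor_exists dcp.
have g2h : src g2 = rng h.
  by rewrite -gh -(src_comp c2) -E2 src_comp.
have Eq : comp e' (comp_seq (src e') q) = comp e2 (comp g2 h).
  by rewrite -E Eg compA // compA // E2.
have [|E3 E4] := factor_unique cq _ Eq (esym de2); first by rewrite rng_comp.
subst e2.
have [r [cr er Er]] := edge_seq_exists h.
have eg' : edge g by apply: edges_deg ee'.
have eg2 : edge g2 by apply: edges_deg ee.
rewrite (IH (src e) p (g :: r)) //=; first last.
- by rewrite gh -Er.
- by move=> x; rewrite inE => /orP[/eqP ->|/er].
- by rewrite -eg eqxx gh.
rewrite (IH (src e') q (g2 :: r)) //=; first last.
- by rewrite g2h -Er.
- by move=> x; rewrite inE => /orP[/eqP ->|/er].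
- by rewrite c2 eqxx g2h.
- by rewrite -sz.
by rewrite !addnA; congr (_ + _)%N; apply: crosses_swap.
Qed.

Definition red_vert := {v : vert L | `[< (~` U) v >]}.
Definition red_edge := {e : mor L | `[<
  (edge `\` (nbhd_edges (~: B)%SET w
             `|` \bigcup_(x in U) edges_into B x)) e >]}.

Lemma red_vertE v : `[< (~` U) v >] = ~~ in_nbhd v.
Proof. by rewrite /in_nbhd -asbool_neg. Qed.

Lemma red_edgeP e : reflect (edge e /\ ~~ in_nbhd (rng e))
  `[< (edge `\` (nbhd_edges (~: B)%SET w
             `|` \bigcup_(x in U) edges_into B x)) e >].
Proof.
apply: (iffP (asboolP _)) => [[ed nU]|[ed Ur]]; split=> //.
  apply/negP => Ur; apply: nU; have [Be|Ce] := edges_split ed.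
    by right; exists (rng e); first exact/asboolP.
  left; split=> //; last exact/asboolP.
  by apply/asboolP; rewrite -/(in_nbhd _) nbhd_closed.
case=> [[_ _ /asboolP]|[x Ux [_ /= rx]]]; first exact/negP.
by move: Ur; rewrite rx => /negP; apply; apply/asboolP.
Qed.

Lemma red_rng_subproof (e : red_edge) : `[< (~` U) (rng (val e)) >].
Proof. by rewrite red_vertE; have /red_edgeP[] := valP e. Qed.

Lemma red_src_subproof (e : red_edge) :
  `[< (~` U) (if in_nbhd (src (val e)) then src (fedge (src (val e)))
              else src (val e)) >].
Proof.
rewrite red_vertE; case: ifPn => // Us.
by apply: edges_into_disj; rewrite ?fedge_rng //; apply: fedge_edges.
Qed.

Definition red_rng (e : red_edge) : red_vert :=
  exist _ (rng (val e)) (red_rng_subproof e).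
Definition red_src (e : red_edge) : red_vert :=
  exist _ (if in_nbhd (src (val e)) then src (fedge (src (val e)))
           else src (val e)) (red_src_subproof e).

Definition red_path := dpath red_src red_rng.
Local Notation chainR := (chain red_src red_rng).

Definition par_edge (e : red_edge) : mor L :=
  if in_nbhd (src (val e)) then comp (val e) (fedge (src (val e)))
  else val e.
Definition par_path (p : red_path) : mor L :=
  comp_seq (val (path_rng p)) (map par_edge (path_edges p)).

Definition tail x : mor L := if in_nbhd x then fedge x else idm x.

Lemma tail_rng x : rng (tail x) = x.
Proof. by rewrite /tail; case: ifPn => [/fedge_rng|_] //; rewrite rng_idm. Qed.

Lemma par_edgeE (e : red_edge) :
  par_edge e = comp (val e) (tail (src (val e))).
Proof. by rewrite /par_edge /tail; case: ifP => //; rewrite comp_idr. Qed.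

Lemma red_srcE (e : red_edge) : val (red_src e) = src (tail (src (val e))).
Proof. by rewrite /= /tail; case: ifP => //; rewrite src_idm. Qed.

Lemma par_edge_rng (e : red_edge) : rng (par_edge e) = val (red_rng e).
Proof. by rewrite par_edgeE rng_comp ?tail_rng. Qed.

Lemma par_edge_src (e : red_edge) : src (par_edge e) = val (red_src e).
Proof. by rewrite par_edgeE src_comp ?tail_rng // red_srcE. Qed.

Definition par_seq (v : red_vert) (es : seq red_edge) : mor L :=
  comp_seq (val v) (map par_edge es).

Lemma par_chain (v : red_vert) es : chainR v es -> chainL (val v) (map par_edge es).
Proof.
elim: es v => //= e es IH v /andP[/eqP <- c].
by rewrite par_edge_rng eqxx par_edge_src IH.
Qed.

Lemma par_last (v : red_vert) es :
  last (val v) (map (@src k L) (map par_edge es)) =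
  val (last v (map red_src es)).
Proof. by elim: es v => //= e es IH v; rewrite par_edge_src IH. Qed.

Lemma par_seq_cons (v : red_vert) (e : red_edge) es :
  par_seq v (e :: es) = comp (par_edge e) (par_seq (red_src e) es).
Proof. by rewrite /par_seq /= par_edge_src. Qed.

Lemma par_seq_rng (v : red_vert) es : chainR v es -> rng (par_seq v es) = val v.
Proof. by move=> /par_chain /comp_seq_rng. Qed.

Lemma par_seq_src (v : red_vert) es : chainR v es ->
  src (par_seq v es) = val (last v (map red_src es)).
Proof. by move=> /par_chain /comp_seq_src ->; rewrite par_last. Qed.

Lemma par_seq_cat (v : red_vert) es es' : chainR v (es ++ es') ->
  par_seq v (es ++ es') =
  comp (par_seq v es) (par_seq (last v (map red_src es)) es').
Proof.
move=> /par_chain; rewrite /par_seq map_cat => /comp_seq_cat ->.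
by rewrite par_last.
Qed.

Definition deg_seq (es : seq red_edge) : 'rV[nat]_k :=
  \sum_(e <- es) deg (val e).

Lemma red_edge_edge (e : red_edge) : edge (val e).
Proof. by have /red_edgeP[] := valP e. Qed.

Lemma red_edge_rng (e : red_edge) : ~~ in_nbhd (rng (val e)).
Proof. by have /red_edgeP[] := valP e. Qed.

Definition expand (e : red_edge) : seq (mor L) :=
  val e :: if in_nbhd (src (val e)) then [:: fedge (src (val e))] else [::].

Lemma expand_chain (v : red_vert) es : chainR v es ->
  chainL (val v) (flatten (map expand es)) /\
  par_seq v es = comp_seq (val v) (flatten (map expand es)).
Proof.
elim: es v => //= e es IH v /andP[/eqP <- c]; rewrite par_seq_cons.
have [c' ->] := IH _ c.
rewrite /= eqxx /par_edge; move: c' => /=.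
case: ifPn => U c' /=; last by [].
rewrite fedge_rng // eqxx; split=> //.
by rewrite compA ?fedge_rng ?comp_seq_rng.
Qed.

Lemma expand_count es :
  count crosses (flatten (map expand es)) =
  count (fun e : red_edge => in_nbhd (src (val e))) es.
Proof.
elim: es => //= e es IH; rewrite count_cat IH.
rewrite {1}/crosses (negPf (red_edge_rng e)) andbF add0n; congr (_ + _)%N.
case: ifPn => //= U; rewrite crossesB ?fedge_rng ?U //.
exact: fedge_edges.
Qed.

Lemma expand_edge es : {in flatten (map expand es), forall e, edge e}.
Proof.
move=> f /flatten_mapP[e _]; rewrite inE => /orP[/eqP ->|].
  exact: red_edge_edge.
by case: ifP => // U; rewrite inE => /eqP ->; apply/edges_sub/fedge_edges.
Qed.

Lemma par_seq_deg (v : red_vert) es : chainR v es -> deg (par_seq v es) =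
  deg_seq es + delta_mx 0 b *+ count (fun e : red_edge => in_nbhd (src (val e))) es.
Proof.
elim: es v => [|e es IH] v /=.
  by rewrite /par_seq /= deg_idm /deg_seq big_nil mulr0n addr0.
move=> /andP[_ c]; rewrite par_seq_cons deg_comp; last first.
  by rewrite par_seq_rng // par_edge_src.
rewrite (IH _ c) /deg_seq big_cons par_edgeE deg_comp ?tail_rng // /tail.
case: ifPn => U; last by rewrite deg_idm addr0 add0n addrA.
by rewrite fedge_deg // mulrS -!addrA; congr (_ + _); rewrite addrCA.
Qed.

Lemma deg_seq_par (v : red_vert) es (v' : red_vert) es' : chainR v es -> chainR v' es' ->
  par_seq v es = par_seq v' es' -> deg_seq es = deg_seq es'.
Proof.
move=> c c' E.
have Ev : v = v' by apply: val_inj; rewrite -(par_seq_rng c) E par_seq_rng.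
subst v'; have := par_seq_deg c; rewrite E (par_seq_deg c').
have [c1 E1] := expand_chain c; have [c2 E2] := expand_chain c'.
rewrite -!expand_count (crosses_count c1 c2) -?E1 -?E2 //; try exact: expand_edge.
by rewrite addrC [RHS]addrC => /rVnat_addI.
Qed.

Lemma deg_seq_size es : size es = (\sum_i deg_seq es ord0 i)%N.
Proof.
elim: es => [|e es IH]; rewrite /deg_seq.
  by rewrite big_nil big1 // => i _; rewrite mxE.
rewrite big_cons; have [c _ ->] := red_edge_edge e.
under [RHS]eq_bigr => i _ do rewrite mxE.
by rewrite big_split /= delta_mx_nat_sum -IH.
Qed.

Lemma par_seq_cancel (v v' : red_vert) (e e' : red_edge) es es' :
  chainR v (e :: es) -> chainR v' (e' :: es') ->
  par_seq v (e :: es) = par_seq v' (e' :: es') ->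
  deg (val e) = deg (val e') ->
  e = e' /\ par_seq (red_src e) es = par_seq (red_src e) es'.
Proof.
move=> /= /andP[_ c] /andP[_ c']; rewrite !par_seq_cons => E d.
have ct : src (tail (src (val e))) = rng (par_seq (red_src e) es).
  by rewrite par_seq_rng // red_srcE.
have ct' : src (tail (src (val e'))) = rng (par_seq (red_src e') es').
  by rewrite par_seq_rng // red_srcE.
move: E; rewrite !par_edgeE -!compA ?tail_rng // => E.
have [||E1 E2] := factor_unique _ _ E d; rewrite ?rng_comp ?tail_rng //.
have {}E1 : e = e' by apply: val_inj.
subst e'; split=> //.
by have [] := factor_unique ct ct' E2 erefl.
Qed.

Lemma red_edge_of e : edge e -> ~~ in_nbhd (rng e) ->
  exists a : red_edge, val a = e.
Proof.
by move=> ed Ur; have P := introT (red_edgeP e) (conj ed Ur); exists (exist _ e P).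
Qed.

Lemma par_swap (a0 a1 : red_edge) : red_src a0 = red_rng a1 ->
  exists a1' a0' : red_edge, [/\ deg (val a1') = deg (val a1),
    red_rng a1' = red_rng a0, red_src a1' = red_rng a0',
    red_src a0' = red_src a1 &
    comp (par_edge a0) (par_edge a1) = comp (par_edge a1') (par_edge a0')].
Proof.
move=> cp0; have : src (tail (src (val a0))) = rng (val a1).
  by rewrite -red_srcE cp0.
move=> cp; have := red_edge_edge a0; have := red_edge_rng a0.
have := red_edge_edge a1; have := red_edge_rng a1.
move Eh : (val a1) cp => h; move Eg : (val a0) => g cp Uh hd Ug gd.
have fin (a1' a0' : red_edge) : deg (val a1') = deg h ->
    rng (val a1') = rng g -> src (tail (src (val a1'))) = rng (val a0') ->
    src (tail (src (val a0'))) = src (tail (src h)) ->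
    comp (comp g (tail (src g))) (comp h (tail (src h))) =
    comp (comp (val a1') (tail (src (val a1'))))
         (comp (val a0') (tail (src (val a0')))) ->
  exists a1' a0' : red_edge, [/\ deg (val a1') = deg h,
    red_rng a1' = red_rng a0, red_src a1' = red_rng a0',
    red_src a0' = red_src a1 &
    comp (par_edge a0) (par_edge a1) = comp (par_edge a1') (par_edge a0')].
  move=> d r1 s1 s0 E; exists a1', a0'; split=> //; last first.
  - by rewrite !par_edgeE Eg Eh.
  - by apply: val_inj; rewrite !red_srcE Eh.
  - by apply: val_inj; rewrite red_srcE.
  - by apply: val_inj; rewrite /= Eg.
have [c _ dh] := hd; have [c' _ dg] := gd.
have edg e : deg e = deg g -> edge e by move=> d; apply: edges_deg gd.
have edh e : deg e = deg h -> edge e by move=> d; apply: edges_deg hd.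
have crg : crosses g = false by rewrite /crosses (negPf Ug) andbF.
have crh : crosses h = false by rewrite /crosses (negPf Uh) andbF.
have [Us|Us] := boolP (in_nbhd (src g)); last first.
  have tg : tail (src g) = idm (src g) by rewrite /tail (negPf Us).
  rewrite tg src_idm in cp.
  have [h' [g' [c1 dh' dg' E1]]] :
      exists h' g', [/\ src h' = rng g', deg h' = deg h, deg g' = deg g
        & comp g h = comp h' g'].
    by apply: factor_exists; rewrite deg_comp // addrC.
  have r1 : rng h' = rng g by rewrite -(rng_comp cp) E1 rng_comp.
  have s1 : src g' = src h by rewrite -(src_comp cp) E1 src_comp.
  have [a1' Ea1] : exists a : red_edge, val a = h'.
    by apply: red_edge_of; rewrite ?r1 //; apply: edh.
  have [Uh'|Uh'] := boolP (in_nbhd (src h')); last first.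
    have [a0' Ea0] : exists a : red_edge, val a = g'.
      by apply: red_edge_of; rewrite -?c1 //; apply: edg.
    have th' : tail (src h') = idm (src h') by rewrite /tail (negPf Uh').
    apply: (fin a1' a0'); rewrite ?Ea1 ?Ea0 ?th' ?src_idm ?s1 //.
    rewrite tg !comp_idr compA ?tail_rng // E1 compA // s1 tail_rng //.
  have : (crosses g + crosses h = crosses h' + crosses g')%N.
    apply: crosses_swap => //.
  rewrite crg crh => /esym/eqP; rewrite addn_eq0 => /andP[_].
  rewrite eqb0 => crg'.
  have Cg' : edges (~: B)%SET g'.
    have [Bg'|//] := edges_split (edg _ dg').
    by move: crg'; rewrite crossesB // -c1 Uh'.
  have Usg' : in_nbhd (src g') by rewrite nbhd_closed // -c1.
  have cf : src g' = rng (fedge (src g')) by rewrite fedge_rng.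
  have [f' [g2 [c2 df' dg2 E2]]] :
      exists f' g2, [/\ src f' = rng g2, deg f' = delta_mx 0 b,
        deg g2 = deg g & comp g' (fedge (src g')) = comp f' g2].
    by apply: factor_exists; rewrite deg_comp // fedge_deg // dg' addrC.
  have rf' : rng f' = src h' by rewrite -(rng_comp c2) -E2 rng_comp.
  have Ef' : f' = tail (src h').
    by rewrite /tail Uh' -rf'; apply: fedge_unique; rewrite ?rf'.
  have sg2 : src g2 = src (fedge (src g')).
    by rewrite -(src_comp c2) -E2 src_comp.
  have Uf' : ~~ in_nbhd (src f').
    by apply: edges_into_disj; [exists b | rewrite rf'].
  have Usf : ~~ in_nbhd (src (fedge (src g'))).
    by apply: edges_into_disj; [apply: fedge_edges | rewrite fedge_rng].
  have [a0' Ea0] : exists a : red_edge, val a = g2.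
    by apply: red_edge_of; rewrite -?c2 //; apply: edg.
  have th : tail (src h) = fedge (src g') by rewrite /tail -s1 Usg'.
  have tg2 : tail (src g2) = idm (src g2) by rewrite /tail sg2 (negPf Usf).
  apply: (fin a1' a0'); rewrite ?Ea1 ?Ea0 //.
  - by rewrite -Ef'.
  - by rewrite tg2 src_idm th.
  rewrite tg tg2 !comp_idr -Ef' th compA ?fedge_rng //.
  rewrite E1 -compA // E2 compA //.
have tg : tail (src g) = fedge (src g) by rewrite /tail Us.
rewrite tg in cp.
have Bg : edges B g.
  have [//|Cg] := edges_split gd.
  by move: Us; rewrite nbhd_closed // (negPf Ug).
have [h1 [f1 [c1 dh1 df1 E1]]] :
    exists h1 f1, [/\ src h1 = rng f1, deg h1 = deg h,
      deg f1 = delta_mx 0 b & comp (fedge (src g)) h = comp h1 f1].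
  by apply: factor_exists; rewrite deg_comp // fedge_deg // addrC.
have rh1 : rng h1 = src g by rewrite -(rng_comp c1) -E1 rng_comp // fedge_rng.
have sf1 : src f1 = src h by rewrite -(src_comp c1) -E1 src_comp.
have [h' [g' [c2 dh' dg' E2]]] :
    exists h' g', [/\ src h' = rng g', deg h' = deg h, deg g' = deg g
      & comp g h1 = comp h' g'].
  by apply: factor_exists; rewrite deg_comp // dh1 addrC.
have r1 : rng h' = rng g by rewrite -(rng_comp (esym rh1)) E2 rng_comp.
have s1 : src g' = src h1 by rewrite -(src_comp (esym rh1)) E2 src_comp.
have [a1' Ea1] : exists a : red_edge, val a = h'.
  by apply: red_edge_of; rewrite ?r1 //; apply: edh.
have [Bh|Ch] := edges_split hd; last first.
  have Ch1 : edges (~: B)%SET h1 by apply: edges_deg Ch.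
  have Ch' : edges (~: B)%SET h' by apply: edges_deg Ch.
  have Ush1 : in_nbhd (src h1) by rewrite nbhd_closed // rh1.
  have Ush' : ~~ in_nbhd (src h') by rewrite nbhd_closed // r1.
  have Ush : ~~ in_nbhd (src h) by rewrite nbhd_closed.
  have Ef1 : f1 = fedge (src h1).
    by rewrite c1; apply: fedge_unique; rewrite -?c1.
  have [a0' Ea0] : exists a : red_edge, val a = g'.
    by apply: red_edge_of; rewrite -?c2 //; apply: edg.
  have th : tail (src h) = idm (src h) by rewrite /tail (negPf Ush).
  have th' : tail (src h') = idm (src h') by rewrite /tail (negPf Ush').
  have tg' : tail (src g') = f1 by rewrite /tail s1 Ush1 Ef1.
  apply: (fin a1' a0'); rewrite ?Ea1 ?Ea0 ?th ?th' ?tg' ?src_idm //.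
  rewrite tg !comp_idr -compA ?fedge_rng // E1 compA // E2 compA //.
  by rewrite s1.
have Bh' : edges B h' by apply: edges_deg Bh.
have Bg' : edges B g' by apply: edges_deg Bg.
have Bh1 : edges B h1 by apply: edges_deg Bh.
have Ug' : in_nbhd (rng g').
  have : (crosses g + crosses h1 = crosses h' + crosses g')%N.
    by apply: crosses_swap; rewrite ?dh1 //; apply: edges_sub; eassumption.
  rewrite crg (crossesB Bh1) rh1 Us (crossesB Bh') r1 (negPf Ug) (crossesB Bg').
  by case: in_nbhd.
have cg'f1 : src g' = rng f1 by rewrite s1.
have [f2 [g2 [c3 df2 dg2 E3]]] :
    exists f2 g2, [/\ src f2 = rng g2, deg f2 = delta_mx 0 b,
      deg g2 = deg g & comp g' f1 = comp f2 g2].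
  by apply: factor_exists; rewrite deg_comp // df1 dg' addrC.
have rf2 : rng f2 = src h' by rewrite c2 -(rng_comp c3) -E3 rng_comp.
have Ef2 : f2 = tail (src h').
  by rewrite /tail c2 Ug' -c2 -rf2; apply: fedge_unique; rewrite ?rf2 ?c2.
have sg2 : src g2 = src h by rewrite -(src_comp c3) -E3 src_comp.
have Uf2 : ~~ in_nbhd (src f2).
  by apply: edges_into_disj; [exists b | rewrite rf2 c2].
have [a0' Ea0] : exists a : red_edge, val a = g2.
  by apply: red_edge_of; rewrite -?c3 //; apply: edg.
apply: (fin a1' a0'); rewrite ?Ea1 ?Ea0 -?Ef2 ?sg2 //.
have -> : comp (comp g (tail (src g))) (comp h (tail (src h))) =
          comp (comp (comp h' f2) g2) (tail (src h)).
  rewrite tg compA ?tail_rng // ?src_comp ?fedge_rng //.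
  rewrite -(compA (f := g)) ?fedge_rng // E1 compA // E2.
  by rewrite -(compA (f := h')) // E3 compA.
by rewrite -compA // ?src_comp ?tail_rng.
Qed.

Lemma deg_seq_has es c : deg_seq es ord0 c != 0 ->
  has (fun a : red_edge => deg (val a) == delta_mx 0 c) es.
Proof.
elim: es => [|a es IH]; rewrite /deg_seq; first by rewrite big_nil mxE eqxx.
rewrite big_cons mxE /=; have [c' _ ->] := red_edge_edge a.
have [->|/negPf cc'] := eqVneq c' c; first by move=> _; rewrite eqxx.
by rewrite mxE eqxx (eq_sym c) cc' add0r => /IH ->; rewrite orbT.
Qed.

Lemma par_front (v : red_vert) es c : chainR v es ->
  has (fun a : red_edge => deg (val a) == delta_mx 0 c) es ->
  exists a es', [/\ chainR v (a :: es'), deg (val a) = delta_mx 0 c,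
    last v (map red_src (a :: es')) = last v (map red_src es)
    & par_seq v (a :: es') = par_seq v es].
Proof.
elim: es v => //= a0 es IH v /andP[/eqP r0 ch].
have [/eqP d0 _|_ /= /(IH _ ch)] := boolP (deg (val a0) == _).
  by exists a0, es; rewrite /= r0 eqxx ch.
move=> [a1 [es1 [/= /andP[/eqP r1 ch1] d1 l1 E1]]].
have [a1' [a0' [d r s1 s0 E]]] := par_swap (esym r1).
exists a1', (a0' :: es1); split=> //=.
- by rewrite r r0 s1 !eqxx s0 ch1.
- by rewrite d.
- by rewrite s0.
rewrite !par_seq_cons s0 -E1 par_seq_cons.
have c1 : src (par_edge a1) = rng (par_seq (red_src a1) es1).
  by rewrite par_seq_rng // par_edge_src.
rewrite !compA ?E // ?par_edge_src ?par_edge_rng ?r1 ?s1 //.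
by rewrite par_seq_rng // s0.
Qed.

Lemma par_unique (v : red_vert) p1 p2 (v' : red_vert) q1 q2 :
  chainR v (p1 ++ p2) -> chainR v' (q1 ++ q2) ->
  par_seq v (p1 ++ p2) = par_seq v' (q1 ++ q2) ->
  deg_seq p1 = deg_seq q1 ->
  par_seq v p1 = par_seq v' q1 /\
  par_seq (last v (map red_src p1)) p2 = par_seq (last v' (map red_src q1)) q2.
Proof.
elim: p1 v v' q1 => [|a p1 IH] v v' q1 cp cq E d.
  have Ev : v = v' by apply: val_inj; rewrite -(par_seq_rng cp) E par_seq_rng.
  subst v'; have : size q1 = 0%N.
    by rewrite deg_seq_size -d -deg_seq_size.
  by move/size0nil => ?; subst q1.
have cq1 : chainR v' q1 by move: cq; rewrite chain_cat => /andP[].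
have [c _ da] := red_edge_edge a.
have [|a' [q1' [c' da' l' E']]] := par_front (c := c) cq1.
  apply: deg_seq_has; rewrite -d /deg_seq big_cons mxE da mxE !eqxx //.
have cq' : chainR v' ((a' :: q1') ++ q2).
  by rewrite chain_cat c' l'; move: cq; rewrite chain_cat => /andP[].
have Eq : par_seq v' ((a' :: q1') ++ q2) = par_seq v' (q1 ++ q2).
  by rewrite !par_seq_cat // E' l'.
have := par_seq_cancel cp cq'; rewrite Eq da da' => -[] // Ea Ec; subst a'.
have [|||E1 E2] := IH (red_src a) (red_src a) q1' _ _ Ec.
- by case/andP: cp.
- by case/andP: cq'.
- have := deg_seq_par c' cq1 E'; rewrite -d /deg_seq !big_cons.
  by move=> /rVnat_addI.
split; first by rewrite -E' !par_seq_cons E1.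
by rewrite -l' /= E2.
Qed.

Lemma par_exists (v : red_vert) p (m n : 'rV[nat]_k) : chainR v p ->
  deg_seq p = m + n ->
  exists p1 p2, [/\ chainR v (p1 ++ p2), deg_seq p1 = m, deg_seq p2 = n
    & par_seq v (p1 ++ p2) = par_seq v p].
Proof.
have [s] := ubnP (size p); elim: s v p m => // s IH v p m lts cp d.
have [m0|/rV0Pn [c mc]] := eqVneq m 0.
  exists [::], p; split=> //; first by rewrite /deg_seq big_nil.
  by rewrite d m0 add0r.
have [|a [q [cq da _ Eq]]] := par_front (c := c) cp.
  by apply: deg_seq_has; rewrite d mxE addn_eq0 negb_and mc.
pose m' : 'rV[nat]_k := \row_i (m ord0 i - (i == c))%N.
have Em : m = delta_mx 0 c + m'.
  apply/rowP => i; rewrite !mxE eqxx /=.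
  by case: eqP => [->|_] //=; [rewrite [RHS]subnKC // lt0n | rewrite subn0].
have dq : deg_seq (a :: q) = m + n by rewrite (deg_seq_par cq cp Eq).
have [|||p1 [p2 [c12 d1 d2 E12]]] := IH (red_src a) q m'.
- rewrite -ltnS; apply: leq_ltn_trans lts.
  by rewrite [X in (_ < X)%N]deg_seq_size d -dq -deg_seq_size.
- by case/andP: cq.
- by apply: (@rVnat_addI k (delta_mx 0 c)); rewrite addrA -Em -dq /deg_seq big_cons da.
exists (a :: p1), p2; split=> //.
- by rewrite /= c12 andbT; case/andP: cq.
- by rewrite /deg_seq big_cons da [LHS]/= -/(deg_seq p1) d1.
- by rewrite -Eq /= !par_seq_cons E12.
Qed.

Definition red_eq (p q : red_path) : bool :=
  if (1 < size (path_edges p))%N && (1 < size (path_edges q))%N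
  then par_path p == par_path q else p == q.

Lemma red_eq_equiv : equiv_class_of red_eq.
Proof.
split=> [p|p q|q p r]; rewrite /red_eq.
- by case: ifP.
- by rewrite andbC; case: ifP => _; rewrite eq_sym.
- case: ifP => [/andP[sp sq]|_] /eqP E1;
    case: ifP => [/andP[sq' sr]|_] /eqP E2.
  + by rewrite sp sr E1 E2 /=.
  + by rewrite -E2 sp sq E1 /=.
  + by rewrite E1 sq' sr E2 /=.
  + by rewrite E1 E2; case: ifP.
Qed.

Canonical red_equiv := EquivRelPack red_eq_equiv.
Definition red_mor := {eq_quot red_eq}.
HB.instance Definition _ := Countable.on red_mor.

Definition red_pi (p : red_path) : red_mor := \pi p.
Definition red_src_mor (x : red_mor) : red_vert := path_src (repr x).
Definition red_rng_mor (x : red_mor) : red_vert := path_rng (repr x).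
Definition red_idm (v : red_vert) : red_mor := red_pi (path_nil _ _ v).
Definition red_comp (x y : red_mor) : red_mor :=
  red_pi (path_cat (repr x) (repr y)).
Definition red_deg (x : red_mor) : 'rV[nat]_k := deg_seq (path_edges (repr x)).
Definition par_mor (x : red_mor) : mor L := par_path (repr x).

Lemma par_pathE (p : red_path) :
  par_path p = par_seq (path_rng p) (path_edges p).
Proof. by []. Qed.

Lemma path_chain (p : red_path) : chainR (path_rng p) (path_edges p).
Proof. exact: (valP p). Qed.

Lemma red_eqP (p q : red_path) :
  reflect (par_path p = par_path q) (red_eq p q).
Proof.
rewrite /red_eq; case: ifP => [_|/negbT sz]; first exact: eqP.
apply: (iffP eqP) => [-> //|E]; apply: val_inj.
have dpq := deg_seq_par (path_chain p) (path_chain q) E.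
have spq : size (path_edges p) = size (path_edges q).
  by rewrite deg_seq_size dpq -deg_seq_size.
move: sz dpq spq (path_chain p) (path_chain q) E; rewrite par_pathE par_pathE.
rewrite /path_edges /path_rng.
case: (val p) => v es; case: (val q) => v' es' /= sz d spq cp cq E.
have Ev : v = v' by apply: val_inj; rewrite -(par_seq_rng cp) E par_seq_rng.
subst v'; congr pair; move: sz cp cq E d spq; rewrite negb_and -!leqNgt.
case: es es' => [|a [|? ?]] [|a' [|? ?]] //= _ cp cq E.
rewrite /deg_seq !big_seq1 => d _.
by have [-> _] := par_seq_cancel (es := [::]) (es' := [::]) cp cq E d.
Qed.

Lemma red_pi_eq (p q : red_path) :
  par_path p = par_path q -> red_pi p = red_pi q.
Proof. by move=> E; apply/eqmodP; apply/red_eqP. Qed.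

Lemma par_mor_pi (p : red_path) : par_mor (red_pi p) = par_path p.
Proof. by apply/red_eqP; rewrite -eqmodE reprK. Qed.

Lemma par_mor_inj : injective par_mor.
Proof.
by move=> x y /red_pi_eq E; rewrite -[x]reprK -[y]reprK.
Qed.

Lemma red_src_morE (x : red_mor) : val (red_src_mor x) = src (par_mor x).
Proof. by rewrite /par_mor par_pathE par_seq_src ?path_chain. Qed.

Lemma red_rng_morE (x : red_mor) : val (red_rng_mor x) = rng (par_mor x).
Proof. by rewrite /par_mor par_pathE par_seq_rng ?path_chain. Qed.

Lemma par_mor_idm (v : red_vert) : par_mor (red_idm v) = idm (val v).
Proof. by rewrite par_mor_pi. Qed.

Lemma par_mor_comp (x y : red_mor) : red_src_mor x = red_rng_mor y ->
  par_mor (red_comp x y) = comp (par_mor x) (par_mor y).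
Proof.
move=> cp; rewrite par_mor_pi /par_mor !par_pathE /path_edges /path_rng.
have := path_chain (path_cat (repr x) (repr y)).
rewrite /path_edges /path_rng path_catE //= => c.
by rewrite par_seq_cat //; congr (comp _ (par_seq _ _)).
Qed.

Lemma red_deg_pi (p : red_path) : red_deg (red_pi p) = deg_seq (path_edges p).
Proof.
apply: deg_seq_par (path_chain _) (path_chain _) _.
exact: (par_mor_pi p).
Qed.

Lemma red_src_idm (v : red_vert) : red_src_mor (red_idm v) = v.
Proof. by apply: val_inj; rewrite red_src_morE par_mor_idm src_idm. Qed.

Lemma red_rng_idm (v : red_vert) : red_rng_mor (red_idm v) = v.
Proof. by apply: val_inj; rewrite red_rng_morE par_mor_idm rng_idm. Qed.

Lemma par_composable (x y : red_mor) : red_src_mor x = red_rng_mor y ->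
  src (par_mor x) = rng (par_mor y).
Proof. by rewrite -red_src_morE -red_rng_morE => ->. Qed.

Lemma red_src_comp (x y : red_mor) : red_src_mor x = red_rng_mor y ->
  red_src_mor (red_comp x y) = red_src_mor y.
Proof.
move=> cp; apply: val_inj; rewrite !red_src_morE par_mor_comp //.
by rewrite src_comp //; apply: par_composable.
Qed.

Lemma red_rng_comp (x y : red_mor) : red_src_mor x = red_rng_mor y ->
  red_rng_mor (red_comp x y) = red_rng_mor x.
Proof.
move=> cp; apply: val_inj; rewrite !red_rng_morE par_mor_comp //.
by rewrite rng_comp //; apply: par_composable.
Qed.

Lemma red_comp_idl (x : red_mor) : red_comp (red_idm (red_rng_mor x)) x = x.
Proof.
apply: par_mor_inj; rewrite par_mor_comp ?red_src_idm //.
by rewrite par_mor_idm red_rng_morE comp_idl.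
Qed.

Lemma red_comp_idr (x : red_mor) : red_comp x (red_idm (red_src_mor x)) = x.
Proof.
apply: par_mor_inj; rewrite par_mor_comp ?red_rng_idm //.
by rewrite par_mor_idm red_src_morE comp_idr.
Qed.

Lemma red_compA (x y z : red_mor) :
  red_src_mor x = red_rng_mor y -> red_src_mor y = red_rng_mor z ->
  red_comp x (red_comp y z) = red_comp (red_comp x y) z.
Proof.
move=> cxy cyz; apply: par_mor_inj.
rewrite !par_mor_comp ?red_src_comp ?red_rng_comp //.
by rewrite compA //; apply: par_composable.
Qed.

Lemma red_deg_idm (v : red_vert) : red_deg (red_idm v) = 0.
Proof. by rewrite red_deg_pi /deg_seq big_nil. Qed.

Lemma red_deg_comp (x y : red_mor) : red_src_mor x = red_rng_mor y ->
  red_deg (red_comp x y) = red_deg x + red_deg y.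
Proof.
move=> cp; rewrite red_deg_pi /path_edges path_catE //=.
by rewrite /deg_seq big_cat.
Qed.

Lemma red_factorization (x : red_mor) (m n : 'rV[nat]_k) : red_deg x = m + n ->
  exists! p : red_mor * red_mor,
    [/\ red_src_mor p.1 = red_rng_mor p.2, red_deg p.1 = m, red_deg p.2 = n
      & x = red_comp p.1 p.2].
Proof.
move=> d.
have [p1 [p2 [c d1 d2 E]]] := par_exists (path_chain _) d.
set v := path_rng _ in c E; set u := last v (map red_src p1).
have := c; rewrite chain_cat -/u => /andP[c1 c2].
pose P1 : red_path := exist _ (v, p1) c1.
pose P2 : red_path := exist _ (u, p2) c2.
have cP : red_src_mor (red_pi P1) = red_rng_mor (red_pi P2).
  apply: val_inj; rewrite red_src_morE red_rng_morE !par_mor_pi !par_pathE.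
  by rewrite par_seq_src // par_seq_rng.
have xE : x = red_comp (red_pi P1) (red_pi P2).
  apply: par_mor_inj; rewrite par_mor_comp // !par_mor_pi !par_pathE.
  by rewrite [LHS]par_pathE -E par_seq_cat.
exists (red_pi P1, red_pi P2); split; first by rewrite !red_deg_pi.
move=> [y z] [/= cyz dy dz xyz].
have := path_chain (path_cat (repr y) (repr z)).
rewrite /path_rng /path_edges path_catE //= => cc.
have [|//|E1 E2] := par_unique c cc.
- rewrite E; have := congr1 par_mor xyz.
  rewrite par_mor_pi !par_pathE /path_rng /path_edges path_catE // => <- //.
- by rewrite d1 -dy.
congr pair; apply: par_mor_inj; rewrite par_mor_pi par_pathE.
- exact: E1.
- by rewrite /= /u E2 -[last _ _]/(path_src (repr y)) -/(red_src_mor y) cyz.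
Qed.

Definition reduction : kgraph k :=
  KGraph red_src_idm red_rng_idm red_src_comp red_rng_comp red_comp_idl
    red_comp_idr red_compA red_deg_idm red_deg_comp red_factorization.

Program Definition par : functor reduction L :=
  @Functor _ _ reduction L (fun v : red_vert => val v) par_mor _ _ _ _.
Next Obligation. by move=> x; exact/esym/red_src_morE. Qed.
Next Obligation. by move=> x; exact/esym/red_rng_morE. Qed.
Next Obligation. exact: par_mor_idm. Qed.
Next Obligation. exact: par_mor_comp. Qed.

End Reduction.

Section Product.
Context (k j : nat).

Section ProductGraph.
Context (L : kgraph k) (O : kgraph j).
Implicit Types f g : mor L * mor O.

Definition prod_src f : vert L * vert O := (src f.1, src f.2).
Definition prod_rng f : vert L * vert O := (rng f.1, rng f.2).
Definition prod_idm (v : vert L * vert O) : mor L * mor O :=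
  (idm v.1, idm v.2).
Definition prod_comp f g : mor L * mor O := (comp f.1 g.1, comp f.2 g.2).
Definition prod_deg f : 'rV[nat]_(k + j) := row_mx (deg f.1) (deg f.2).

Lemma prod_factorization f (m n : 'rV[nat]_(k + j)) : prod_deg f = m + n ->
  exists! p : (mor L * mor O) * (mor L * mor O),
    [/\ prod_src p.1 = prod_rng p.2, prod_deg p.1 = m, prod_deg p.2 = n
      & f = prod_comp p.1 p.2].
Proof.
case: f => f g; rewrite -[m]hsubmxK -[n]hsubmxK add_row_mx => /eq_row_mx[/= d1 d2].
have [f1 [f2 [cf df1 df2 Ef]]] := factor_exists d1.
have [g1 [g2 [cg dg1 dg2 Eg]]] := factor_exists d2.
exists ((f1, g1), (f2, g2)); split.
  by split; rewrite /prod_src /prod_rng /prod_deg /prod_comp /= ?cf ?cg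
    ?df1 ?dg1 ?df2 ?dg2 ?Ef ?Eg.
move=> [[f1' g1'] [f2' g2']] [/= [cf' cg'] /eq_row_mx[/= df1' dg1'] _ [Ef' Eg']].
have [|<- <-] := factor_unique cf cf' (etrans (esym Ef) Ef').
  by rewrite df1 df1'.
have [|<- <- //] := factor_unique cg cg' (etrans (esym Eg) Eg').
by rewrite dg1 dg1'.
Qed.

Program Definition kprod : kgraph (k + j) :=
  @KGraph _ (vert L * vert O)%type (mor L * mor O)%type prod_src prod_rng
    prod_idm prod_comp prod_deg _ _ _ _ _ _ _ _ _ prod_factorization.
Next Obligation. by case=> *; rewrite /prod_src /= !src_idm. Qed.
Next Obligation. by case=> *; rewrite /prod_rng /= !rng_idm. Qed.
Next Obligation. by move=> f g [? ?]; rewrite /prod_src /= !src_comp. Qed.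
Next Obligation. by move=> f g [? ?]; rewrite /prod_rng /= !rng_comp. Qed.
Next Obligation. by case=> *; rewrite /prod_comp /= !comp_idl. Qed.
Next Obligation. by case=> *; rewrite /prod_comp /= !comp_idr. Qed.
Next Obligation.
by move=> f g h [? ?] [? ?]; rewrite /prod_comp /= !compA.
Qed.
Next Obligation. by case=> *; rewrite /prod_deg /= !deg_idm row_mx0. Qed.
Next Obligation.
by move=> f g [? ?]; rewrite /prod_deg /= !deg_comp // add_row_mx.
Qed.

End ProductGraph.

End Product.

Program Definition functor_prod k j k' j' (L : kgraph k) (O : kgraph j)
    (L' : kgraph k') (O' : kgraph j') (F : functor L L') (G : functor O O') :
    functor (kprod L O) (kprod L' O') :=
  @Functor _ _ (kprod L O) (kprod L' O')
    (fun v => (fvert F v.1, fvert G v.2))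
    (fun f => (fmor F f.1, fmor G f.2)) _ _ _ _.
Next Obligation. by move=> *; rewrite /= /prod_src /= !functor_src. Qed.
Next Obligation. by move=> *; rewrite /= /prod_rng /= !functor_rng. Qed.
Next Obligation. by move=> *; rewrite /prod_idm /= !functor_idm. Qed.
Next Obligation.
by move=> k j k' j' L O L' O' F G f g [? ?]; rewrite /prod_comp /= !functor_comp. Qed.

(* Main.v *)
(** The colors of the second factor lie outside [B'], so the [B']-neighborhood
    of [(w, y)] is the product of the neighborhood of [w] and the connected
    component of [y], and an edge of the product is an edge of one factor paired
    with a vertex of the other; this gives [HR] factor by factor. When [Omega] is
    connected the removed vertices are exactly those over the neighborhood of
    [w]. Parent functors are injective on morphisms, so a morphism of a reduction
    can be identified with its parent: [Phi] exists and is bijective as soon as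
    the image of [par] for the product equals (image of [par]) x [mor Omega],
    which is checked on identities and edges and extended by composition. *)
Require Import Defs.
From Stdlib Require Import Relation_Operators.
From mathcomp Require Import all_boot all_algebra.
From mathcomp Require Import boolp classical_sets.

Set Implicit Arguments.
Unset Strict Implicit.
Unset Printing Implicit Defensive.

Import GRing.Theory.

(** * Morphisms of degree zero and factorizations of identities *)

Section Degree.
Local Open Scope ring_scope.
Context (k : nat) (L : kgraph k).
Implicit Types f g : mor L.

Lemma deg0_loop f : deg f = 0 -> rng f = src f.
Proof. by move=> /deg0_idm ->; rewrite rng_idm src_idm. Qed.

Lemma rVnat_addr_eq0 (m n : 'rV[nat]_k) : m + n = 0 -> m = 0 /\ n = 0.
Proof.
move=> /rowP E; split; apply/rowP => i; have /eqP := E i.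
  by rewrite !mxE addn_eq0 => /andP[/eqP].
by rewrite !mxE addn_eq0 => /andP[_ /eqP].
Qed.

(** Degrees are natural vectors, so two degrees with sum 0 both vanish. In a commuting square of the
    product this forces a coordinate that starts as an identity to stay one. *)
Lemma comp_eq_idm f g z : src f = rng g -> idm z = Defs.comp f g ->
  f = idm z /\ g = idm z.
Proof.
move=> cp E; have := deg_comp cp; rewrite -E deg_idm.
move=> /esym /rVnat_addr_eq0 [df dg].
have sg : src g = z by rewrite -(src_comp cp) -E src_idm.
have sf : src f = z by rewrite -(deg0_loop df) -(rng_comp cp) -E rng_idm.
by rewrite (deg0_idm df) (deg0_idm dg) sf sg.
Qed.

Lemma edge_deg_neq0 (C : {set 'I_k}) f : edges C f -> deg f <> 0.
Proof. by move=> [c _ ->]; apply: delta_mx_nat_neq0. Qed.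

End Degree.

(** * Edges and neighborhoods in a product, and [HR] for the product *)

Section ProductEdges.
Local Open Scope ring_scope.
Context (k j : nat) (L : kgraph k) (O : kgraph j).
Local Notation LO := (kprod L O).
Implicit Types (e : mor LO) (B : {set 'I_k}).

Lemma prod_deg_lshift e c : deg e = delta_mx 0 (lshift j c) <->
  deg e.1 = delta_mx 0 c /\ deg e.2 = 0.
Proof.
rewrite delta_mx_lshift /= /prod_deg.
by split=> [/eq_row_mx [-> ->]|[-> ->]].
Qed.

Lemma prod_deg_rshift e c : deg e = delta_mx 0 (rshift k c) <->
  deg e.1 = 0 /\ deg e.2 = delta_mx 0 c.
Proof.
rewrite delta_mx_rshift /= /prod_deg.
by split=> [/eq_row_mx [-> ->]|[-> ->]].
Qed.

Lemma lshift_imset B c : (lshift j c \in lshift j @: B) = (c \in B).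
Proof. by rewrite mem_imset //; apply: lshift_inj. Qed.

Lemma rshift_imset B c : (rshift k c \in lshift j @: B) = false.
Proof. by apply/imsetP => -[i _ /eqP]; rewrite eq_rlshift. Qed.

Lemma edges_prod_lshift B e :
  edges (lshift j @: B) e <-> edges B e.1 /\ deg e.2 = 0.
Proof.
split=> [[c /imsetP[c' c'B ->] /prod_deg_lshift [d1 d2]]|[[c cB d1] d2]].
  by split=> //; exists c'.
by exists (lshift j c); [rewrite lshift_imset | apply/prod_deg_lshift].
Qed.

(** A basis vector of the sum lives in one of the two blocks, so one coordinate of an edge has
    degree 0. Colors from the right block are never in [lshift j @: B], hence the second case is
    unrestricted. *)
Lemma edges_prod_compl B e : edges (~: (lshift j @: B))%SET e <->
  (edges (~: B)%SET e.1 /\ deg e.2 = 0) \/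
  (deg e.1 = 0 /\ edges [set: 'I_j]%SET e.2).
Proof.
split.
- move=> [c]; case: (split_ordP c) => i ->.
    rewrite finset.in_setC lshift_imset => iB /prod_deg_lshift [d1 d2].
    by left; split=> //; exists i; rewrite // finset.in_setC.
  by move=> _ /prod_deg_rshift [d1 d2]; right; split=> //; exists i; rewrite ?inE.
- move=> [[[c cB d1] d2]|[d1 [c _ d2]]].
    exists (lshift j c); last exact/prod_deg_lshift.
    by rewrite finset.in_setC lshift_imset -finset.in_setC.
  exists (rshift k c); last exact/prod_deg_rshift.
  by rewrite finset.in_setC rshift_imset.
Qed.

Lemma edges_prod e : edges [set: 'I_(k + j)]%SET e <->
  (edges [set: 'I_k]%SET e.1 /\ deg e.2 = 0) \/
  (deg e.1 = 0 /\ edges [set: 'I_j]%SET e.2).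
Proof.
have := edges_prod_compl finset.set0 e.
by rewrite imset0 !finset.setC0.
Qed.

Context (B : {set 'I_k}) (w : vert L) (y : vert O).
Local Notation B' := (lshift j @: B).

(** Each undirected step in the product moves only one coordinate, so a walk projects to walks in
    both factors. *)
Lemma nbhd_prod (x : vert L) (z : vert O) :
  nbhd (~: B')%SET ((w, y) : vert LO) (x, z) <->
  nbhd (~: B)%SET w x /\ nbhd [set: 'I_j]%SET y z.
Proof.
split.
  suff P (a a' : vert LO) :
      clos_refl_sym_trans _ (adjacent (~: B')%SET) a a' ->
      nbhd (~: B)%SET a.1 a'.1 /\ nbhd [set: 'I_j]%SET a.2 a'.2.
    by move=> /P.
  elim=> {a a'}.
  - move=> a a' [e /edges_prod_compl [[e1 d2]|[d1 e2]] [<- <-]] /=; split.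
    + by apply: rst_step; exists e.1.
    + by rewrite (deg0_loop d2); apply: rst_refl.
    + by rewrite (deg0_loop d1); apply: rst_refl.
    + by apply: rst_step; exists e.2.
  - by move=> a; split; apply: rst_refl.
  - by move=> a a' _ [? ?]; split; apply: rst_sym.
  - move=> a a' a'' _ [h1 h2] _ [h3 h4].
    by split; [apply: rst_trans h1 h3 | apply: rst_trans h2 h4].
(* Conversely, walk from [w] to [x] over the fixed vertex [y], then from [y] to [z] over the fixed
   vertex [x]. *)
move=> [h1 h2]; apply: (rst_trans _ _ _ (x, y)).
  elim: h1.
  - move=> a a' [e ee [<- <-]]; apply: rst_step; exists (e, idm y) => /=.
      by apply/edges_prod_compl; left; rewrite deg_idm.
    by rewrite /prod_src /prod_rng /= src_idm rng_idm.
  - by move=> a; apply: rst_refl.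
  - by move=> a a' _ ?; apply: rst_sym.
  - by move=> a a' a'' _ h _; apply: rst_trans.
elim: h2.
- move=> a a' [e ee [<- <-]]; apply: rst_step; exists (idm x, e) => /=.
    by apply/edges_prod_compl; right; rewrite deg_idm.
  by rewrite /prod_src /prod_rng /= src_idm rng_idm.
- by move=> a; apply: rst_refl.
- by move=> a a' _ ?; apply: rst_sym.
- by move=> a a' a'' _ h _; apply: rst_trans.
Qed.

Lemma edges_into_prod (x : vert L) (z : vert O) e :
  edges_into B' ((x, z) : vert LO) e <-> edges_into B x e.1 /\ e.2 = idm z.
Proof.
case: e => f g; split.
  move=> [/edges_prod_lshift /= [ef dg] [/= <- <-]].
  by rewrite (deg0_loop dg) -deg0_idm.
move=> [[/= ef rf] ->]; split; first by apply/edges_prod_lshift; rewrite deg_idm.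
by rewrite /= /prod_rng /= rf rng_idm.
Qed.

Lemma edges_from_prod (x : vert L) (z : vert O) e :
  edges_from B' ((x, z) : vert LO) e <-> edges_from B x e.1 /\ e.2 = idm z.
Proof.
case: e => f g; split.
  by move=> [/edges_prod_lshift /= [ef dg] [/= <- <-]]; rewrite -deg0_idm.
move=> [[/= ef sf] ->]; split; first by apply/edges_prod_lshift; rewrite deg_idm.
by rewrite /= /prod_src /= sf src_idm.
Qed.

Lemma reducible_prod (x : vert L) (z : vert O) :
  reducible x B -> reducible ((x, z) : vert LO) B'.
Proof.
move=> [B0 [v [hv hb hl hs]]]; split.
  have /set0Pn[c cB] := B0.
  by apply/set0Pn; exists (lshift j c); rewrite lshift_imset.
have [f [ef sf]] : exists f, edges_into B x f /\ src f = v.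
  by have /seteqP[_ /(_ v erefl) [f ? ?]] := hs; exists f.
exists (v, z); split.
- move=> e /edges_prod [[e1 d2]|[d1 _]] [r1 r2] [s1 s2].
    by apply/edges_prod_lshift; split=> //; apply: hv.
  (* An edge in the [O] direction fixes the first coordinate, so [x = v] and [f] would be a loop at
     [x] with color in [B], which reducibility excludes. *)
  case: hl; exists f; last by case: ef.
  by case: ef => ef _; split=> //=; rewrite sf -s1 -r1 (deg0_loop d1).
- move=> b /imsetP[b0 /hb [g [[rg dg] gU]] ->].
  exists (g, idm z); split.
    split; last by apply/prod_deg_lshift; rewrite deg_idm.
    by rewrite /= /prod_rng /= rg rng_idm.
  move=> [g' h] [[r1 r2] /prod_deg_lshift [/= d1 d2]].
  by rewrite (gU g') // (deg0_idm d2) -(deg0_loop d2) r2.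
- move=> [e /edges_from_prod [e1 _] [r1 _]]; apply: hl.
  by exists e.1.
- apply/seteqP; split=> [_ [e /edges_into_prod [e1 e2] <-]|_ ->] /=.
    rewrite /prod_src e2 src_idm; congr pair.
    by have /seteqP[/(_ (src e.1)) + _] := hs; apply; exists e.1.
  exists (f, idm z); first by apply/edges_into_prod.
  by rewrite /= /prod_src /= sf src_idm.
Qed.

(** Edges with color in [B'] have an identity as second coordinate. The second coordinate of a
    square through them is therefore a factorization of [idm z], hence trivial, and the first
    coordinate is a square in [L]. *)
Lemma stationary_prod (x : vert L) (z : vert O) :
  stationary B (edges_into B x) ->
  stationary B' (edges_into B' ((x, z) : vert LO)).
Proof.
move=> [_ st]; split=> [e [ee _]|]; first exact: edges_sub ee.
move=> [f1 g1] [f2 g2] /edges_into_prod [/= F1 ->] /edges_into_prod [/= F2 ->].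
have [s12 r12 stl str] := st _ _ F1 F2.
have edge1 (nu : mor LO) : edges [set: 'I_(k + j)]%SET nu -> deg nu.2 = 0 ->
    edges [set: 'I_k]%SET nu.1.
  move=> /edges_prod [[]//|[_ e2]] d2.
  by case: (edge_deg_neq0 e2).
split.
- by rewrite /prod_src /= s12.
- by rewrite /prod_rng /= r12.
- move=> [l l'] [nu1 nu2] [mu1 mu2]; rewrite /prod_rng /= rng_idm.
  move=> /edges_from_prod [/= lf ->] enu emu [cp1 cp2] [E1 E2].
  have := comp_idl (idm z); rewrite rng_idm E2 => /esym/(comp_eq_idm cp2) [n2 m2].
  apply/edges_into_prod; split=> //=.
  apply: (stl l nu1 mu1) => //.
    by apply: (edge1 _ enu); rewrite /= n2 deg_idm.
  by apply: (edge1 _ emu); rewrite /= m2 deg_idm.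
- move=> [l l'] [nu1 nu2] [mu1 mu2]; rewrite /prod_src /= src_idm.
  move=> /edges_into_prod [/= lf ->] enu emu [cp1 cp2] [E1 E2].
  have := comp_idl (idm z); rewrite rng_idm E2 => /esym/(comp_eq_idm cp2) [n2 m2].
  apply/edges_into_prod; split=> //=.
  apply: (str l nu1 mu1) => //.
    by apply: (edge1 _ enu); rewrite /= n2 deg_idm.
  by apply: (edge1 _ emu); rewrite /= m2 deg_idm.
Qed.

Lemma HR_prod : HR w B -> HR ((w, y) : vert LO) B'.
Proof.
move=> [[red dis] st]; split; [split|].
- by move=> [x z] /nbhd_prod [/red Ux _]; apply: reducible_prod.
- rewrite -subset0 => e [[[x z] /nbhd_prod [Ux _] /edges_from_prod [e1 _]]].
  move=> [[x' z'] /nbhd_prod [Ux' _] /edges_into_prod [e1' _]].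
  have /seteqP[/(_ e.1) + _] := dis; apply.
  by split; [exists x | exists x'].
- by move=> [x z] /nbhd_prod [/st Ux _]; apply: stationary_prod.
Qed.

End ProductEdges.

(** * The image of the parent functor, with degrees in the reduction *)

Section ParentImage.
Local Open Scope ring_scope.
Context (k : nat) (L : kgraph k) (w : vert L) (B : {set 'I_k}) (b : 'I_k).
Context (hb : b \in B) (H : HR w B).

(** The degree is recorded separately because [par] does not preserve it: an edge whose source is in
    the neighborhood gains an edge of color [b]. *)
Definition par_img (m : mor L) (d : 'rV[nat]_k) :=
  exists2 X : red_mor hb H, par_mor X = m & red_deg X = d.

Lemma par_img_idm v : ~~ in_nbhd w B v -> par_img (idm v) 0.
Proof.
rewrite -red_vertE => Uv.
exists (red_idm hb H (exist _ v Uv)); first exact: par_mor_idm.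
exact: red_deg_idm.
Qed.

Lemma par_img_edge (a : red_edge w B) : par_img (par_edge b a) (deg (val a)).
Proof.
pose p : red_path hb H :=
  exist (fun p => chain (red_src hb H) (@red_rng _ _ w B) p.1 p.2)
    (red_rng a, [:: a]) (introT andP (conj (eqxx _) isT)).
exists (red_pi p).
  by rewrite par_mor_pi /par_path /= comp_idr.
by rewrite red_deg_pi /deg_seq big_seq1.
Qed.

Lemma par_img_comp m m' d d' : src m = rng m' ->
  par_img m d -> par_img m' d' -> par_img (Defs.comp m m') (d + d').
Proof.
move=> cp [X Xm Xd] [Y Ym Yd].
have cXY : red_src_mor X = red_rng_mor Y.
  by apply: val_inj; rewrite red_src_morE red_rng_morE Xm Ym.
by exists (red_comp X Y); rewrite ?par_mor_comp ?red_deg_comp // ?Xm ?Ym ?Xd ?Yd.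
Qed.

Lemma par_img_src m d : par_img m d -> ~~ in_nbhd w B (src m).
Proof. by move=> [X <- _]; rewrite -red_src_morE -red_vertE; exact: (valP (red_src_mor X)). Qed.

(** Induction on the edge list of a representative path. Only parents and degrees occur in [P], so
    the quotient never has to be handled in its applications. *)
Lemma par_mor_ind (P : mor L -> 'rV[nat]_k -> Prop) :
  (forall v, ~~ in_nbhd w B v -> P (idm v) 0) ->
  (forall (a : red_edge w B) m d, src (par_edge b a) = rng m ->
    P m d -> P (Defs.comp (par_edge b a) m) (deg (val a) + d)) ->
  forall X : red_mor hb H, P (par_mor X) (red_deg X).
Proof.
move=> P0 PS X; rewrite /par_mor /red_deg par_pathE.
move: (path_rng _) (path_edges _) (path_chain (repr X)) => v es.
elim: es v => [|a es IH] v /=.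
  move=> _; rewrite /deg_seq big_nil; apply: P0.
  by rewrite -red_vertE; exact: (valP v).
move=> /andP[_ c]; rewrite (par_seq_cons hb H) /deg_seq big_cons.
apply: PS; last exact: IH.
by rewrite (par_seq_rng c) (par_edge_src hb H).
Qed.

End ParentImage.

(** * Comparison of the two parent images when the second factor is connected *)

Section ProductReduction.
Local Open Scope ring_scope.
Context (k j : nat) (L : kgraph k) (O : kgraph j).
Local Notation LO := (kprod L O).
Context (w : vert L) (y : vert O) (B : {set 'I_k}) (b : 'I_k).
Context (hb : b \in B) (H : HR w B).
Local Notation B' := (lshift j @: B).
Local Notation wy := ((w, y) : vert LO).
Context (hb' : lshift j b \in B') (H' : HR wy B').
Context (cO : connected_kgraph O).

(** By connectedness the component of [y] is all of [O], so the condition on [z] in [nbhd_prod]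
    always holds. *)
Lemma in_nbhd_prod (x : vert L) (z : vert O) :
  in_nbhd wy B' (x, z) = in_nbhd w B x.
Proof.
by apply/asboolP/asboolP => [/nbhd_prod []//|?]; apply/nbhd_prod; split.
Qed.

(** The right-hand side has range [(x, z)] and color [lshift j b], and such an edge is unique. *)
Lemma fedge_prod (x : vert L) (z : vert O) : in_nbhd w B x ->
  fedge (L := LO) (lshift j b) (x, z) = (fedge b x, idm z).
Proof.
move=> Ux; have [rx dx] := fedgeP hb H Ux.
have r : rng ((fedge b x, idm z) : mor LO) = (x, z).
  by rewrite /= /prod_rng /= rx rng_idm.
have := @fedge_unique _ _ _ _ _ hb' H' ((fedge b x, idm z) : mor LO).
rewrite r in_nbhd_prod => /(_ Ux) <- //.
by apply/prod_deg_lshift; rewrite deg_idm.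
Qed.

Lemma par_edge_prod (a : red_edge w B) (a' : red_edge wy B') z :
  val a' = (val a, idm z) -> par_edge (lshift j b) a' = (par_edge b a, idm z).
Proof.
rewrite /par_edge => -> /=; rewrite /prod_src /= src_idm in_nbhd_prod.
case: ifP => // Ux; rewrite fedge_prod // /prod_comp /=.
by rewrite -{1}(rng_idm z) comp_idl.
Qed.

(** The range of [a'] lies outside the neighborhood and its source has the same first coordinate
    [x], so nothing is appended. *)
Lemma par_edge_idm (a' : red_edge wy B') x g :
  val a' = (idm x, g) -> par_edge (lshift j b) a' = (idm x, g).
Proof.
move=> E; rewrite /par_edge E /= /prod_src /= src_idm in_nbhd_prod.
have := red_edge_rng a'; rewrite E /= /prod_rng /= rng_idm in_nbhd_prod.
by move=> /negPf ->.
Qed.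

(** Each edge [a] of a path for [X] lifts to the edge [(val a, idm z)] of the product reduction,
    with matching parents. *)
Lemma par_img_prodL (X : red_mor hb H) z :
  par_img hb' H' (par_mor X, idm z) (row_mx (red_deg X) 0).
Proof.
apply: (par_mor_ind (P := fun m d => par_img hb' H' (m, idm z) (row_mx d 0))) X
  => [v Uv|a m d cp].
  rewrite row_mx0.
  by apply: (par_img_idm hb' H' (v := (v, z))); rewrite in_nbhd_prod.
have [a' Ea'] : exists a' : red_edge wy B', val a' = (val a, idm z).
  apply: red_edge_of.
    by apply/edges_prod; left; rewrite deg_idm; split=> //; apply: red_edge_edge.
  by rewrite /= /prod_rng /= in_nbhd_prod; apply: red_edge_rng.
move=> Pm; have := par_img_comp _ (par_img_edge hb' H' a') Pm.
rewrite (par_edge_prod Ea') Ea' /= /prod_src /prod_rng /= /prod_deg /= deg_idm.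
rewrite add_row_mx addr0 /prod_comp /= src_idm rng_idm cp.
by rewrite -{3}(rng_idm z) comp_idl; apply.
Qed.

(** Factor [g] into edges [e]; each [(idm x, e)] survives the reduction and is its own parent. *)
Lemma par_img_prodR (x : vert L) (g : mor O) : ~~ in_nbhd w B x ->
  par_img hb' H' (idm x, g) (row_mx 0 (deg g)).
Proof.
move=> Ux; have [es [c ed ->]] := edge_seq_exists g.
elim: es (rng g) c ed => [|e es IH] z /=.
  rewrite deg_idm row_mx0 => _ _.
  by apply: (par_img_idm hb' H' (v := (x, z))); rewrite in_nbhd_prod.
move=> /andP[_ c] ed.
have {}IH := IH _ c (fun a aes => ed a (mem_behead (s := e :: es) aes)).
have [a' Ea'] : exists a' : red_edge wy B', val a' = (idm x, e).
  apply: red_edge_of; last by rewrite /= /prod_rng /= rng_idm in_nbhd_prod.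
  by apply/edges_prod; right; rewrite deg_idm; split=> //; apply: ed; rewrite mem_head.
have ce : src e = rng (comp_seq (src e) es) by rewrite comp_seq_rng.
have := par_img_comp _ (par_img_edge hb' H' a') IH.
rewrite (par_edge_idm Ea') Ea' /= /prod_src /prod_rng /= /prod_deg /= deg_idm.
rewrite add_row_mx addr0 /prod_comp /= src_idm rng_idm -ce (deg_comp ce).
by rewrite -{3}(rng_idm x) comp_idl; apply.
Qed.

(** Split the pair as [(par_mor X, idm)] after [(idm, g)]; the middle vertex is over the source of
    [par_mor X], which is outside the neighborhood. *)
Lemma par_img_prod (X : red_mor hb H) (g : mor O) :
  par_img hb' H' (par_mor X, g) (row_mx (red_deg X) (deg g)).
Proof.
have UX : ~~ in_nbhd w B (src (par_mor X)).
  by apply: (@par_img_src _ _ _ _ _ hb H _ (red_deg X)); exists X.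
have := par_img_comp _ (par_img_prodL X (rng g)) (par_img_prodR g UX).
rewrite /= /prod_src /prod_rng /prod_comp /= add_row_mx addr0 add0r.
by rewrite src_idm rng_idm comp_idl comp_idr; apply.
Qed.

(** Converse inclusion of images. A reduced edge of the product projects to a reduced edge of [L] or
    to an identity. *)
Lemma par_mor_prod (Y : red_mor hb' H') :
  exists X : red_mor hb H, par_mor X = (par_mor Y).1.
Proof.
suff [X] : par_img hb H (par_mor Y).1 (lsubmx (red_deg Y)) by exists X.
apply: (par_mor_ind (P := fun (m : mor LO) d => par_img hb H m.1 (lsubmx d))) Y
  => [[v z]|a' m d].
  by rewrite in_nbhd_prod linear0; apply: par_img_idm.
move=> cp Pm; rewrite linearD /=.
have Ur := red_edge_rng a'; have ed := red_edge_edge a'.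
have [f [g Ea']] : exists f g, val a' = (f, g) by case: (val a') => f g; exists f, g.
rewrite row_mxKl -[sval a']/(val a') Ea'.
move: ed Ur; rewrite Ea' in_nbhd_prod.
move=> /edges_prod /= [[ef dg]|[df _]] Ur.
  have [a Ea] := red_edge_of ef Ur.
  have Ep : par_edge (lshift j b) a' = (par_edge b a, idm (src g)).
    by apply: par_edge_prod; rewrite Ea -deg0_idm.
  rewrite Ep /= -Ea; apply: par_img_comp; last by []; last exact: par_img_edge.
  by move: cp; rewrite Ep => -[].
(* An edge in the [O] direction projects to an identity of degree 0, so the first coordinate of the
   composite is that of [m]. *)
move: Ea'; rewrite (deg0_idm df) => Ea'; move: cp.
rewrite (par_edge_idm Ea') deg_idm add0r => -[/= + _].
by rewrite src_idm => ->; rewrite comp_idl.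
Qed.

End ProductReduction.

(** * Assembly of the isomorphism from the equality of parent images *)

Theorem theorem5p9 (k j : nat) (Lambda : kgraph k) (w : vert Lambda)
  (B : {set 'I_k}) (b : 'I_k) (hb : b \in B) (H : HR w B)
  (Omega : kgraph j) (y : vert Omega) :
  let LO := kprod Lambda Omega in
  let wy : vert LO := (w, y) in
  let B' : {set 'I_(k + j)} := lshift j @: B in
  HR wy B' /\
  forall (hb' : lshift j b \in B') (H' : HR wy B'),
    connected_kgraph Omega ->
    exists Phi : functor (kprod (reduction hb H) Omega) (reduction hb' H'),
      kgraph_iso Phi /\
      functor_eq (functor_compose (par hb' H') Phi)
                 (functor_prod (par hb H) (functor_id Omega)).
Proof.
move=> LO wy B'; split=> [|hb' H' cO]; first exact: HR_prod.
(* [phi] and [psi] are chosen by their parents alone, which determine them because [par_mor] is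
   injective; the degree clause yields degree preservation. *)
have /choice[phi phiP] (p : red_mor hb H * mor Omega) :
    exists Y : red_mor hb' H', par_mor Y = (par_mor p.1, p.2) /\
      red_deg Y = row_mx (red_deg p.1) (deg p.2).
  by have [Y ? ?] := par_img_prod hb' H' cO p.1 p.2; exists Y.
have /choice[psi psiP] (Y : red_mor hb' H') :
    exists p : red_mor hb H * mor Omega, (par_mor p.1, p.2) = par_mor Y.
  have [X EX] := par_mor_prod hb H cO Y.
  by exists (X, (par_mor Y).2); rewrite EX -surjective_pairing.
have /choice[phi0 phi0P] (v : red_vert w B * vert Omega) :
    exists v' : red_vert wy B', val v' = (val v.1, v.2).
  case: v => -[v Uv] z; have := Uv.
  rewrite red_vertE -(in_nbhd_prod _ y B cO v z) -red_vertE => Uv'.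
  by exists (exist _ (v, z) Uv').
have /choice[psi0 psi0P] (v' : red_vert wy B') :
    exists v : red_vert w B * vert Omega, (val v.1, v.2) = val v'.
  case: v' => -[v z] Uv; have := Uv.
  rewrite red_vertE in_nbhd_prod // -red_vertE => Uv'.
  by exists (exist _ v Uv', z).
(* The functor laws are checked after passing to [LO], through the injections [val] on vertices and
   [par_mor] on morphisms. *)
have sphi p : red_src_mor (phi p) = phi0 (red_src_mor p.1, src p.2).
  by apply: val_inj; rewrite red_src_morE (phiP p).1 phi0P /= red_src_morE.
have rphi p : red_rng_mor (phi p) = phi0 (red_rng_mor p.1, rng p.2).
  by apply: val_inj; rewrite red_rng_morE (phiP p).1 phi0P /= red_rng_morE.
have iphi v : phi (red_idm hb H v.1, idm v.2) = red_idm hb' H' (phi0 v).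
  apply: par_mor_inj; rewrite (phiP _).1 /= !par_mor_idm.
  by rewrite phi0P.
have cphi p q : red_src_mor p.1 = red_rng_mor q.1 -> src p.2 = rng q.2 ->
    phi (red_comp p.1 q.1, Defs.comp p.2 q.2) = red_comp (phi p) (phi q).
  move=> c1 c2; apply: par_mor_inj; rewrite (phiP _).1 /= !par_mor_comp //.
    by rewrite !(phiP _).1.
  by rewrite sphi rphi c1 c2.
pose Phi : functor (kprod (reduction hb H) Omega) (reduction hb' H') :=
  @Functor _ _ (kprod (reduction hb H) Omega) (reduction hb' H') phi0 phi
    sphi rphi iphi
    (fun p q (E : prod_src p = prod_rng q) =>
       cphi p q (congr1 fst E) (congr1 snd E)).
exists Phi; split; last first.
  split=> [v|p] /=; first by rewrite phi0P.
  by rewrite (phiP p).1.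
split=> /=.
- exists psi0.
    move=> [v z]; have := psi0P (phi0 (v, z)); rewrite phi0P /=.
    by case: (psi0 _) => v' z' /= [/val_inj -> ->].
  by move=> v'; apply: val_inj; rewrite phi0P psi0P.
- exists psi.
    move=> [X g]; have := psiP (phi (X, g)); rewrite (phiP _).1 /=.
    by case: (psi _) => X' g' /= [/par_mor_inj -> ->].
  by move=> Y; apply: par_mor_inj; rewrite (phiP _).1 psiP.
- by move=> p; rewrite (phiP p).2.
Qed.
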